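(* Suppose $\mu$ and $\varepsilon$ are two real numbers with $\varepsilon \le \frac{\mu^{2}}{4}$. Let $b=\frac{\mu - \sqrt{\mu^2 - 4\varepsilon}}{2}$. Then $$ \begin{aligned} &\int_0^{+\infty} \big(x f'' + x f' + \mu f' + (\mu-b) f\big)^2 x^{\mu-1} dx\\ &\qquad= \int_{0}^{+\infty}\left(x^{2}(f')^{2}-\varepsilon f^{2}\right)x^{\mu-1}dx -\left(\sqrt{\mu^{2}-4\varepsilon}+1\right) \int_{0}^{+\infty}(f')^{2}x^{\mu}dx+\int_{0}^{+\infty}(f'')^{2}x^{\mu+1}dx \end{aligned} $$ and $$ \left(\int_{0}^{+\infty} (f'')^2 x^{\mu+1} dx\right) \left( \int_{0}^{+\infty} \left( x^2 (f')^2 - \varepsilon f^2 \right) x^{\mu-1} dx\right) \ge \frac{1}{4}\left(\sqrt{\mu^{2}-4\varepsilon}+1\right)^{2}\left( \int_{0}^{+\infty} (f')^2 x^{\mu} dx \right)^2 $$ hold for all $f\in\bar{\mathcal{E}}_\mu(\mathbb{R}_+)$.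
   Context: Let $\mathbb{R}_+=(0,+\infty)$ and $\mu\in\mathbb{R}$. For a twice differentiable real-valued function $f$ on $\mathbb{R}_+$, set $$ \|f\| := \left( \int_{0}^{+\infty} \left(x^{\mu+1}(f'')^2 +(x^{\mu+1}+x^{\mu-1})(f')^2+x^{\mu-1}f^{2}\right) dx \right)^{1/2}. $$ Let $\mathcal{E}_\mu(\mathbb{R}_+):= \{ f \in C^{\infty}(\mathbb{R}_+) : \|f\| < +\infty \}$ (real-valued functions), and let $\bar{\mathcal{E}}_\mu(\mathbb{R}_+)$ be the Hilbert space completion of $\mathcal{E}_\mu(\mathbb{R}_+)$ with respect to $\|\cdot\|$. Elements of $\bar{\mathcal{E}}_\mu(\mathbb{R}_+)$ are regarded in the usual way as (continuously differentiable representatives of) real-valued functions on $\mathbb{R}_+$, with $f''$ understood as a weak derivative. *)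

(* Defs.v *)
From HB Require Import structures.
From mathcomp Require Import all_boot all_order all_algebra.
From mathcomp Require Import all_classical all_reals all_analysis.

Set Implicit Arguments.
Unset Strict Implicit.
Unset Printing Implicit Defensive.

Import Order.TTheory GRing.Theory Num.Theory.
Import numFieldNormedType.Exports.

Local Open Scope ring_scope.
Local Open Scope classical_set_scope.

(* Functions on (0, +oo) are represented by total functions R -> R of which
   only the values at positive arguments are ever used. *)
Definition Rpos (R : realType) : set R := `]0, +oo[.
Arguments Rpos {R}.

Definition smooth_on (R : realType) (D : set R) (f : R -> R) : Prop :=
  forall (n : nat) (x : R), D x -> derivable (derive1n n f) x 1.

Definition C1_on (R : realType) (D : set R) (f : R -> R) : Prop :=
  forall x : R, D x -> derivable f x 1 /\ {for x, continuous (derive1 f)}.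

(* C^oo functions whose support is a compact subset of (0, +oo) *)
Definition test_function (R : realType) (phi : R -> R) : Prop :=
  smooth_on setT phi /\
  exists a b : R, 0 < a /\ forall x, phi x != 0 -> a <= x <= b.

Definition weak_derivative (R : realType) (h g : R -> R) : Prop :=
  [/\ locally_integrable Rpos h,
      locally_integrable Rpos g &
      forall phi : R -> R, test_function phi ->
        \int[lebesgue_measure]_(x in Rpos) (h x * derive1 phi x) =
        - \int[lebesgue_measure]_(x in Rpos) (g x * phi x)].

(* The norm of f. The second derivative f2 is a separate argument, so that it
   may be the classical one or a representative of the weak one. *)
Definition enorm (R : realType) (mu : R) (f f2 : R -> R) : \bar R :=
  ((\int[lebesgue_measure]_(x in Rpos)
     (x `^ (mu + 1) * f2 x ^+ 2
      + (x `^ (mu + 1) + x `^ (mu - 1)) * derive1 f x ^+ 2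
      + x `^ (mu - 1) * f x ^+ 2)%:E) `^ 2^-1)%E.

Definition E_space (R : realType) (mu : R) : set (R -> R) :=
  [set f | smooth_on Rpos f /\ (enorm mu f (derive1n 2 f) < +oo)%E].

(* The completion of E_space mu, each class of Cauchy sequences being
   identified with the C^1 representative of its limit, which is twice weakly
   differentiable. *)
Definition Ebar (R : realType) (mu : R) : set (R -> R) :=
  [set f | C1_on Rpos f /\
    exists f2 : R -> R, weak_derivative (derive1 f) f2 /\
    exists u : nat -> R -> R,
      (forall n, E_space mu (u n)) /\
      enorm mu (u n \- f) (derive1n 2 (u n) \- f2) @[n --> \oo] --> 0%E].

(* Main.v *)
(* For c = mu - b one has eps = c (mu - c) and sqrt(mu^2 - 4 eps) + 1 =
   2 c - mu + 1. For smooth f and every real lam, expanding the square shows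
   that
     (x f'' + lam x f' + mu f' + lam c f)^2 x^(mu-1)
     - [lam^2 (x^2 f'^2 - eps f^2) x^(mu-1) - lam (2 c - mu + 1) f'^2 x^mu
        + f''^2 x^(mu+1)]
   is the derivative of a function G with |G| <= K x e(x), where e is the
   integrand of the squared norm. As e is integrable and 1/x is not, x e(x)
   tends to 0 along some sequences tending to 0 and to +oo, so the integral of
   the difference vanishes. It is a continuous quadratic form for the norm, so
   it vanishes on the completion too. Taking lam = 1 gives the identity; the
   inequality is the nonpositivity of the discriminant in lam. The given weak
   derivative agrees a.e. with the limit of the second derivatives because the
   indicator of an interval is a bounded pointwise limit of bump functions. *)

Require Import Defs.
From HB Require Import structures.
From mathcomp Require Import all_boot all_order all_algebra.
From mathcomp Require Import all_classical all_reals all_analysis.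
From mathcomp Require Import measurable_realfun.
From mathcomp Require Import ring lra.

Import Order.TTheory GRing.Theory Num.Theory.
Import numFieldNormedType.Exports.

Local Open Scope ring_scope.
Local Open Scope classical_set_scope.

(** * Pointwise identities and bounds *)

Section Pointwise.
Context {R : realType}.
Implicit Types (f g h : R -> R) (mu lam c x y z p q r : R).

(** The integrand of the squared norm, with [p], [q], [r] standing for the values of f, f', f'' at
    [x], so that pointwise estimates become algebra in independent variables. *)
Definition energy mu x p q r :=
  x `^ (mu + 1) * r ^+ 2 + (x `^ (mu + 1) + x `^ (mu - 1)) * q ^+ 2
  + x `^ (mu - 1) * p ^+ 2.

(* The paper's parameters are recovered for c = mu - b: then c (mu - c) is eps
   and 2 c - mu + 1 is sqrt(mu^2 - 4 eps) + 1. *)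
Definition defect mu lam c x p q r :=
  (x * r + lam * x * q + mu * q + lam * c * p) ^+ 2 * x `^ (mu - 1)
  - (lam ^+ 2 * ((x ^+ 2 * q ^+ 2 - c * (mu - c) * p ^+ 2) * x `^ (mu - 1))
     - lam * (2 * c - mu + 1) * (q ^+ 2 * x `^ mu)
     + r ^+ 2 * x `^ (mu + 1)).

(** Each term comes from integrating by parts one of the mixed products r q, r p, q p in the
    expanded square. *)
Definition defect_primitive mu lam c x p q :=
  lam * (x `^ (mu + 1) * (q * q)) + mu * (x `^ mu * (q * q))
  + 2 * lam * c * (x `^ mu * (q * p)) + lam ^+ 2 * c * (x `^ mu * (p * p)).

Lemma powR_pred mu x : 0 < x -> x `^ mu = x * x `^ (mu - 1).
Proof.
move=> x0; rewrite -{2}[x]powRr1 ?ltW// -powRD ?(gt_eqF x0) ?implybT//.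
by rewrite addrC subrK.
Qed.

Lemma powR_succ mu x : 0 < x -> x `^ (mu + 1) = x ^+ 2 * x `^ (mu - 1).
Proof. by move=> x0; rewrite powR_pred// addrK (powR_pred mu)// mulrA. Qed.

Lemma is_derive_defect_primitive mu lam c f g h x : 0 < x ->
  is_derive x 1 f (g x) -> is_derive x 1 g (h x) ->
  is_derive x 1 (fun y => defect_primitive mu lam c y (f y) (g y))
    (defect mu lam c x (f x) (g x) (h x)).
Proof.
move=> x0 df dg.
have dP a : is_derive x 1 (@powR R ^~ a) (a * x `^ (a - 1)).
  exact: is_derive1_powR.
have -> : (fun y => defect_primitive mu lam c y (f y) (g y)) =
  lam *: ((@powR R ^~ (mu + 1)) * (g * g)) + mu *: ((@powR R ^~ mu) * (g * g))
  + (2 * lam * c) *: ((@powR R ^~ mu) * (g * f))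
  + (lam ^+ 2 * c) *: ((@powR R ^~ mu) * (f * f)) by [].
have dgg := is_deriveM dg dg.
have dgf := is_deriveM dg df.
have dff := is_deriveM df df.
have d1 := is_deriveZ lam (is_deriveM (dP (mu + 1)) dgg).
have d2 := is_deriveZ mu (is_deriveM (dP mu) dgg).
have d3 := is_deriveZ (2 * lam * c) (is_deriveM (dP mu) dgf).
have d4 := is_deriveZ (lam ^+ 2 * c) (is_deriveM (dP mu) dff).
have := is_deriveD (is_deriveD (is_deriveD d1 d2) d3) d4.
move=> /is_derive_eq; apply.
rewrite /defect /GRing.scale /= addrK.
(* Once every power of [x] is expressed through x^(mu - 1), the claim is a polynomial identity. *)
rewrite powR_succ// (powR_pred mu)//.
rewrite -![(_ * _) x]/(_ x * _ x).
move: (x `^ (mu - 1)) (f x) (g x) (h x) => X p q r.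
ring.
Qed.

Lemma energyE mu x p q r : 0 < x -> energy mu x p q r =
  x `^ (mu - 1) * ((x * r) ^+ 2 + (x * q) ^+ 2 + q ^+ 2 + p ^+ 2).
Proof. by move=> x0; rewrite /energy powR_succ//; ring. Qed.

Lemma energy_ge0 mu x p q r : 0 <= energy mu x p q r.
Proof.
by rewrite /energy !addr_ge0// mulr_ge0 ?sqr_ge0 ?powR_ge0// addr_ge0 ?powR_ge0.
Qed.

(** Parallelogram identity: the right side minus the left side is the energy of the sums. *)
Lemma energy_triangle mu x p q r p' q' r' :
  energy mu x (p - p') (q - q') (r - r') <=
  2 * energy mu x p q r + 2 * energy mu x p' q' r'.
Proof.
rewrite /energy; have := powR_ge0 x (mu + 1); have := powR_ge0 x (mu - 1).
move: (x `^ (mu + 1)) (x `^ (mu - 1)) => A B B0 A0.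
rewrite -subr_ge0 [leRHS](_ : _ =
  A * (r + r') ^+ 2 + (A + B) * (q + q') ^+ 2 + B * (p + p') ^+ 2); last ring.
by rewrite !addr_ge0// mulr_ge0 ?sqr_ge0// addr_ge0.
Qed.

(* Up to the factor x^(mu - 1) the defect is a quadratic form in x r, x q, q
   and p, the four quantities whose squares make up the energy. *)
Lemma defectE mu lam c x p q r : 0 < x -> defect mu lam c x p q r =
  x `^ (mu - 1) * (2 * lam * (x * r * (x * q)) + 2 * mu * (x * r * q)
    + 2 * lam * c * (x * r * p) + lam * (mu + 2 * c + 1) * (x * q * q)
    + 2 * lam ^+ 2 * c * (x * q * p) + mu ^+ 2 * (q * q)
    + 2 * lam * mu * c * (q * p) + lam ^+ 2 * c * mu * (p * p)).
Proof.
move=> x0; rewrite /defect powR_succ// (powR_pred mu)//.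
move: (x `^ (mu - 1)) => X.
ring.
Qed.

Lemma sqr_le_sum4 (a b c d : R) (S := a ^+ 2 + b ^+ 2 + c ^+ 2 + d ^+ 2) :
  [/\ a ^+ 2 <= S, b ^+ 2 <= S, c ^+ 2 <= S & d ^+ 2 <= S].
Proof.
have := sqr_ge0 a; have := sqr_ge0 b; have := sqr_ge0 c; have := sqr_ge0 d.
by rewrite /S; split; lra.
Qed.

(** Young's inequality with weight [d] handles the two mixed products, and y' z' is at most [W]. The
    free [d] makes the coefficient of the unperturbed bound [V] as small as desired. *)
Lemma mulr_perturb (d V W y z y' z' : R) : 0 < d ->
  y ^+ 2 <= V -> z ^+ 2 <= V -> y' ^+ 2 <= W -> z' ^+ 2 <= W ->
  `|(y + y') * (z + z') - y * z| <= d * V + (d^-1 + 1) * W.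
Proof.
move=> d0 yV zV yW zW.
have n2 t : 2 * `|t| = `|2 * t| by rewrite normrM gtr0_norm.
have young (t t' : R) : t ^+ 2 <= V -> t' ^+ 2 <= W ->
    2 * `|t * t'| <= d * V + d^-1 * W.
  move=> tV tW.
  have dV : d * t ^+ 2 <= d * V by rewrite ler_pM2l.
  have dW : d^-1 * t' ^+ 2 <= d^-1 * W by rewrite ler_pM2l ?invr_gt0.
  have sq e : 0 <= d^-1 * (d * t + e * t') ^+ 2.
    by rewrite mulr_ge0 ?sqr_ge0// invr_ge0 ltW.
  have sqE e : d^-1 * (d * t + e * t') ^+ 2 =
      d * t ^+ 2 + 2 * e * (t * t') + e ^+ 2 * (d^-1 * t' ^+ 2).
    by field; rewrite gt_eqF.
  (* The two signs bound [t * t'] from below and from above. *)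
  have := sq 1; have := sq (-1); rewrite !sqE n2 ler_norml; lra.
have -> : (y + y') * (z + z') - y * z = y * z' + z * y' + y' * z' by ring.
have W2 : 2 * `|y' * z'| <= 2 * W.
  rewrite n2 ler_norml; have := sqr_ge0 (y' - z'); have := sqr_ge0 (y' + z').
  by rewrite sqrrB sqrrD; lra.
have := young _ _ yV zW; have := young _ _ zV yW.
have := ler_normD (y * z' + z * y') (y' * z').
have := ler_normD (y * z') (z * y').
by rewrite mulrDl mul1r; lra.
Qed.

(** [mulr_perturb] applied to each of the eight products of [defectE]. [K] is fixed before [d],
    which allows [d] to be chosen small later. *)
Lemma defect_perturb mu lam c : exists2 K, 0 <= K &
  forall (d x p q r p' q' r' : R), 0 < d -> 0 < x ->
  `|defect mu lam c x (p + p') (q + q') (r + r') - defect mu lam c x p q r|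
  <= K * (d * energy mu x p q r + (d^-1 + 1) * energy mu x p' q' r').
Proof.
(* The sum of the absolute values of the coefficients in [defectE]. *)
exists (`|2 * lam| + `|2 * mu| + `|2 * lam * c| + `|lam * (mu + 2 * c + 1)|
  + `|2 * lam ^+ 2 * c| + `|mu ^+ 2| + `|2 * lam * mu * c|
  + `|lam ^+ 2 * c * mu|); first by rewrite !addr_ge0.
move=> d x p q r p' q' r' d0 x0; rewrite !defectE// !energyE// -mulrBr.
rewrite normrM (ger0_norm (powR_ge0 _ _)).
set V := (_ + p ^+ 2); set W := (_ + p' ^+ 2).
set K := (X in _ <= X * _); set T := d * V + (d^-1 + 1) * W.
have -> : K * (d * (x `^ (mu - 1) * V) + (d^-1 + 1) * (x `^ (mu - 1) * W)) =
  x `^ (mu - 1) * (K * T) by rewrite /T; ring.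
apply: ler_wpM2l; first exact: powR_ge0.
have bnd k y z y' z' : y ^+ 2 <= V -> z ^+ 2 <= V -> y' ^+ 2 <= W ->
    z' ^+ 2 <= W -> `|k * ((y + y') * (z + z') - y * z)| <= `|k| * T.
  by move=> *; rewrite normrM ler_wpM2l// mulr_perturb.
have [? ? ? ?] : [/\ (x * r) ^+ 2 <= V, (x * q) ^+ 2 <= V, q ^+ 2 <= V
  & p ^+ 2 <= V] by exact: sqr_le_sum4.
have [? ? ? ?] : [/\ (x * r') ^+ 2 <= W, (x * q') ^+ 2 <= W, q' ^+ 2 <= W
  & p' ^+ 2 <= W] by exact: sqr_le_sum4.
rewrite [X in `|X|](_ : _ =
  2 * lam * ((x * r + x * r') * (x * q + x * q') - x * r * (x * q))
  + 2 * mu * ((x * r + x * r') * (q + q') - x * r * q)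
  + 2 * lam * c * ((x * r + x * r') * (p + p') - x * r * p)
  + lam * (mu + 2 * c + 1) * ((x * q + x * q') * (q + q') - x * q * q)
  + 2 * lam ^+ 2 * c * ((x * q + x * q') * (p + p') - x * q * p)
  + mu ^+ 2 * ((q + q') * (q + q') - q * q)
  + 2 * lam * mu * c * ((q + q') * (p + p') - q * p)
  + lam ^+ 2 * c * mu * ((p + p') * (p + p') - p * p)); last ring.
rewrite /K; do 7 (rewrite [leRHS]mulrDl;
  apply: le_trans (ler_normD _ _) _; apply: lerD; last by apply: bnd).
exact: bnd.
Qed.

(** A perturbation of zero with d = 1, where d^-1 + 1 = 2. *)
Lemma defect_bound mu lam c : exists2 K, 0 <= K &
  forall (x p q r : R), 0 < x ->
  `|defect mu lam c x p q r| <= K * energy mu x p q r.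
Proof.
have [K K0 H] := defect_perturb mu lam c.
exists (K * 2); first by rewrite mulr_ge0.
move=> x p q r x0; have := H 1 x 0 0 0 p q r ltr01 x0.
rewrite !add0r invr1 (@energyE mu x 0 0 0)// (@defectE mu lam c x 0 0 0)//.
by rewrite !(mulr0, expr0n, addr0, add0r, subr0) mulrA.
Qed.

(** Every term is x x^(mu - 1) times a product of two of the quantities x q, q, p, and each such
    product is at most their sum of squares. In the leading term the second factor [x] goes into x
    q. *)
Lemma defect_primitive_bound mu lam c : exists2 K, 0 <= K &
  forall (x p q r : R), 0 < x ->
  `|defect_primitive mu lam c x p q| <= K * (x * energy mu x p q r).
Proof.
exists (`|lam| + `|mu| + `|2 * lam * c| + `|lam ^+ 2 * c|).
  by rewrite !addr_ge0.
move=> x p q r x0.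
rewrite /defect_primitive energyE// powR_succ// (powR_pred mu)//.
set V := (_ + p ^+ 2); move: (powR_ge0 x (mu - 1)).
move: (x `^ (mu - 1)) => X X0.
have prod y z : y ^+ 2 <= V -> z ^+ 2 <= V -> `|y * z| <= V.
  move=> yV zV; rewrite ler_norml.
  by have := sqr_ge0 (y - z); have := sqr_ge0 (y + z); rewrite sqrrB sqrrD; lra.
have [_ ? ? ?] : [/\ (x * r) ^+ 2 <= V, (x * q) ^+ 2 <= V, q ^+ 2 <= V
  & p ^+ 2 <= V] by exact: sqr_le_sum4.
have bnd k y z : y ^+ 2 <= V -> z ^+ 2 <= V ->
    `|k * (x * X * (y * z))| <= `|k| * (x * (X * V)).
  move=> yV zV; rewrite normrM ler_wpM2l// !normrM.
  rewrite (gtr0_norm x0) (ger0_norm X0).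
  by rewrite -mulrA ler_pM2l// ler_wpM2l// -normrM prod.
have -> : x ^+ 2 * X * (q * q) = x * X * (x * q * q) by ring.
do 3 (rewrite [leRHS]mulrDl;
  apply: le_trans (ler_normD _ _) _; apply: lerD; last by apply: bnd).
exact: bnd.
Qed.

End Pointwise.

(** * The identity for smooth functions *)

Section DominatedConvergence.
Context {R : realType}.
Implicit Types (f g h u v w : R -> R) (mu lam c T : R).
Local Notation leb := (@lebesgue_measure R).

Lemma RposE (x : R) : Rpos x <-> 0 < x.
Proof. by rewrite /Rpos /= in_itv /= andbT. Qed.

Lemma measurable_Rpos : measurable (@Rpos R).
Proof. exact: measurable_itv. Qed.

Lemma open_Rpos : open (@Rpos R).
Proof. exact: interval_open. Qed.

Lemma itv_sub_Rpos (a b : R) : 0 < a -> `[a, b] `<=` (@Rpos R).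
Proof.
move=> a0 x; rewrite /= in_itv/= => /andP[ax _].
by apply/RposE/(lt_le_trans a0).
Qed.

Lemma dominated_cvg_Rintegral {d} {T : measurableType d}
    (m : {measure set T -> \bar R}) (D : set T) (f_ : nat -> T -> R)
    (f g : T -> R) :
  measurable D -> (forall n, measurable_fun D (f_ n)) -> measurable_fun D f ->
  (forall x : T, D x -> f_ ^~ x @ \oo --> f x) ->
  m.-integrable D (EFin \o g) -> (forall n (x : T), D x -> `|f_ n x| <= g x) ->
  \int[m]_(x in D) f_ n x @[n --> \oo] --> \int[m]_(x in D) f x.
Proof.
move=> mD mf_ mf f_f ig f_g.
have [|||//||ifD _ cv] := @dominated_convergence _ _ _ m D mD
  (fun n => EFin \o f_ n) (EFin \o f) (EFin \o g).
- by move=> n; apply/measurable_EFinP.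
- exact/measurable_EFinP.
- by apply: aeW => x Dx; apply: cvg_EFin; [exact: nearW|exact: f_f].
- by apply: aeW => x n Dx; rewrite /= lee_fin f_g.
- by rewrite /Rintegral; apply: fine_cvg; rewrite fineK ?integrable_fin_num.
Qed.

(** Dominated convergence for the restrictions of [h], with bound |h|. It serves both for windows
    that escape ([A] empty) and for exhausting intervals ([A] equal to [D]). *)
Lemma cvg_Rintegral_subset {d} {T : measurableType d}
    (m : {measure set T -> \bar R}) (D A : set T) (A_ : nat -> set T)
    (h : T -> R) :
  measurable D -> measurable A -> (forall n, measurable (A_ n)) ->
  A `<=` D -> (forall n, A_ n `<=` D) -> m.-integrable D (EFin \o h) ->
  (forall x : T, D x -> \forall n \near \oo, A_ n x <-> A x) ->
  \int[m]_(x in A_ n) h x @[n --> \oo] --> \int[m]_(x in A) h x.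
Proof.
move=> mD mA mA_ AD A_D ih A_A.
have mh : measurable_fun D h by apply/measurable_EFinP/(measurable_int m).
have sub B : B `<=` D ->
    \int[m]_(x in B) h x = \int[m]_(x in D) (h \_ B) x.
  by move=> BD; rewrite -Rintegral_mkcondr setIidr.
have mres B : measurable B -> B `<=` D -> measurable_fun D (h \_ B).
  move=> mB BD; apply/(measurable_restrict _ _ _) => //.
  by apply: measurable_funS mh => //; exact: subIsetl.
rewrite (sub A)//; under eq_fun do rewrite sub//.
apply: (@dominated_cvg_Rintegral _ _ _ _ _ _ (fun x => `|h x|)) => //.
- by move=> n; exact: mres.
- exact: mres.
- move=> x Dx; apply: cvg_near_cst; near=> n.
  have nA : A_ n x <-> A x by near: n; exact: A_A.
  by rewrite !patchE; congr (if _ then _ else _); apply/idP/idP;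
    rewrite !inE => /nA.
- exact: integrable_norm.
- by move=> n x Dx; rewrite patchE /=; case: ifP; rewrite ?normr0.
Unshelve. all: by end_near. Qed.

End DominatedConvergence.

(** * Continuity of the integrands and decay along sequences tending to the ends of (0, +oo) *)

Section BoundaryValues.
Context {R : realType}.
Implicit Types (f g h u v w : R -> R) (mu lam c T : R).
Local Notation leb := (@lebesgue_measure R).

Lemma measurable_fun_Rpos h :
  (forall x, 0 < x -> {for x, continuous h}) -> measurable_fun Rpos h.
Proof.
move=> ch; apply: open_continuous_measurable_fun; first exact: open_Rpos.
by move=> x /[!inE] /RposE; exact: ch.
Qed.

Lemma within_continuous_itv h (a b : R) : 0 < a ->
  (forall x, 0 < x -> {for x, continuous h}) -> {within `[a, b], continuous h}.
Proof.
move=> a0 ch; apply: continuous_in_subspaceT => x /[!inE] xab.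
by apply/ch/RposE; apply: (itv_sub_Rpos _ _ a0); exact: xab.
Qed.

Lemma continuous_powR_pos (a x : R) : 0 < x ->
  {for x, continuous (fun y : R => y `^ a)}.
Proof.
move=> x0; apply/differentiable_continuous/derivable1_diffP.
by apply: ex_derive; exact: is_derive1_powR.
Qed.

Lemma continuous_energy mu f g h (x : R) : 0 < x ->
  {for x, continuous f} -> {for x, continuous g} -> {for x, continuous h} ->
  {for x, continuous (fun y => energy mu y (f y) (g y) (h y))}.
Proof.
move=> x0 cf cg ch; have cp a := continuous_powR_pos a x x0.
have D k l := @continuousD R R R k l x; have M k l := @continuousM R R k l x.
have sq (k : R -> R) : {for x, continuous k} ->
    {for x, continuous (fun y => k y ^+ 2)} by move=> ck; exact: M.
have e1 := M _ _ (cp (mu + 1)) (sq _ ch).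
have e2 := M _ _ (D _ _ (cp (mu + 1)) (cp (mu - 1))) (sq _ cg).
exact: (D _ _ (D _ _ e1 e2) (M _ _ (cp (mu - 1)) (sq _ cf))).
Qed.

Lemma continuous_defect mu lam c f g h (x : R) : 0 < x ->
  {for x, continuous f} -> {for x, continuous g} -> {for x, continuous h} ->
  {for x, continuous (fun y => defect mu lam c y (f y) (g y) (h y))}.
Proof.
move=> x0 cf cg ch; have cp a := continuous_powR_pos a x x0.
have D k l := @continuousD R R R k l x; have M k l := @continuousM R R k l x.
have B k l := @continuousB R R R k l x.
have sq (k : R -> R) : {for x, continuous k} ->
    {for x, continuous (fun y => k y ^+ 2)} by move=> ck; exact: M.
have cst (a : R) : {for x, continuous (fun=> a : R)} by exact: cvg_cst.
have id : {for x, continuous (fun y : R => y)} by exact: cvg_id.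
have l := D _ _ (D _ _ (D _ _ (M _ _ id ch) (M _ _ (M _ _ (cst lam) id) cg))
  (M _ _ (cst mu) cg)) (M _ _ (cst (lam * c)) cf).
have q1 := B _ _ (M _ _ (sq _ id) (sq _ cg))
  (M _ _ (cst (c * (mu - c))) (sq _ cf)).
have q2 := M _ _ (cst (lam ^+ 2)) (M _ _ q1 (cp (mu - 1))).
have q3 := M _ _ (cst (lam * (2 * c - mu + 1))) (M _ _ (sq _ cg) (cp mu)).
have q4 := M _ _ (sq _ ch) (cp (mu + 1)).
exact: (B _ _ (M _ _ (sq _ l) (cp (mu - 1))) (D _ _ (B _ _ q2 q3) q4)).
Qed.

(** [y] is a minimum point of [h] on the window, whose length is [T]. *)
Lemma window_le_Rintegral h T : 0 < T ->
  (forall x, 0 < x -> {for x, continuous h}) ->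
  exists2 y, T <= y <= 2 * T & T * h y <= \int[leb]_(x in `[T, 2 * T]) h x.
Proof.
move=> T0 ch; have T2 : T <= 2 * T by rewrite ler_peMl ?ltW// ltr1n.
have ch' := within_continuous_itv _ _ _ T0 ch.
have [y yT hy] := EVT_min T2 (ch' (2 * T)).
exists y; first by rewrite in_itv/= in yT.
apply: (@le_trans _ _ (\int[leb]_(x in `[T, 2 * T]) (cst (h y) x))).
  rewrite Rintegral_cst//= lebesgue_measure_itv/= lte_fin ltr_pMl ?ltr1n//.
  by rewrite -EFinD/= [X in _ <= _ * X](_ : _ = T) 1?mulrC//; ring.
apply: le_Rintegral => //.
- apply: continuous_compact_integrable; first exact: segment_compact.
  by apply: continuous_subspaceT => ?; exact: cvg_cst.
- by apply: continuous_compact_integrable; [exact: segment_compact|exact: ch'].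
Qed.

(* On [T, 2T] the minimum of h times T is at most the integral of h there, which
   tends to 0 when the windows [T, 2T] leave every compact of (0, +oo). *)
Lemma window_cvg0 h (T_ : nat -> R) : (forall n, 0 < T_ n) ->
  (forall x, 0 < x -> \forall n \near \oo, ~ (T_ n <= x <= 2 * T_ n)) ->
  (forall x, 0 < x -> {for x, continuous h}) -> (forall x, 0 < x -> 0 <= h x) ->
  leb.-integrable Rpos (EFin \o h) ->
  exists2 y_ : nat -> R, forall n, T_ n <= y_ n <= 2 * T_ n &
    y_ n * h (y_ n) @[n --> \oo] --> 0.
Proof.
move=> T0 TN ch h0 ih.
have [y_ yT hy] : exists2 y_ : nat -> R, forall n, T_ n <= y_ n <= 2 * T_ n &
    forall n, T_ n * h (y_ n) <= \int[leb]_(x in `[T_ n, 2 * T_ n]) h x.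
  have H n : exists y, T_ n <= y <= 2 * T_ n /\
      T_ n * h y <= \int[leb]_(x in `[T_ n, 2 * T_ n]) h x.
    by have [y] := window_le_Rintegral _ _ (T0 n) ch; exists y.
  by have [y_ Hy] := choice H; exists y_ => n; have [] := Hy n.
exists y_ => //.
have y0 n : 0 < y_ n by have /andP[/(lt_le_trans (T0 n))] := yT n.
have cv : \int[leb]_(x in `[T_ n, 2 * T_ n]) h x @[n --> \oo] --> (0 : R).
  rewrite -(Rintegral_set0 leb h).
  apply: (@cvg_Rintegral_subset _ _ _ leb Rpos) => //.
  - exact: measurable_Rpos.
  - by move=> n; exact: itv_sub_Rpos.
  - move=> x /RposE /TN; apply: filterS => n nT.
    by split=> [|[]]; rewrite /= in_itv.
(* The factor 2 pays for replacing [T_ n] by [y_ n], which is at most [2 * T_ n]. *)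
have cv2 : 2 * \int[leb]_(x in `[T_ n, 2 * T_ n]) h x @[n --> \oo] --> (0 : R).
  by rewrite -[X in _ --> X](mulr0 2); apply: cvgM; [exact: cvg_cst|exact: cv].
apply: (squeeze_cvgr _ (@cvg_cst _ 0 _ _ _) cv2); apply: nearW => n.
rewrite mulr_ge0 ?h0 ?(ltW (y0 n))//=.
apply: (@le_trans _ _ (2 * (T_ n * h (y_ n)))); last by rewrite ler_pM2l.
rewrite mulrA.
by apply: ler_wpM2r; [exact: h0|have /andP[] := yT n].
Qed.
End BoundaryValues.

(** * Vanishing of the integrated defect for smooth functions *)

Section SmoothIdentity.
Context {R : realType}.
Implicit Types (F f g h u v w : R -> R) (mu lam c T x : R).
Local Notation leb := (@lebesgue_measure R).

Lemma cvg_norm_le0 (a_ b_ : nat -> R) K : (forall n, `|a_ n| <= K * b_ n) ->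
  b_ n @[n --> \oo] --> 0 -> a_ n @[n --> \oo] --> (0 : R).
Proof.
move=> ab b0; apply: norm_cvg0.
have Kb : K * b_ n @[n --> \oo] --> (0 : R).
  by rewrite -[X in _ --> X](mulr0 K); apply: cvgM; [exact: cvg_cst|].
apply: (squeeze_cvgr _ (@cvg_cst _ 0 _ _ _) Kb); apply: nearW => n.
by rewrite normr_ge0 ab.
Qed.

Lemma Rintegral_itv_is_derive F g (a b : R) : 0 < a -> a < b ->
  (forall x, 0 < x -> is_derive x 1 F (g x)) ->
  (forall x, 0 < x -> {for x, continuous g}) ->
  \int[leb]_(x in `[a, b]) g x = F b - F a.
Proof.
move=> a0 ab dF cg; rewrite /Rintegral.
have cF (x : R) : 0 < x -> {for x, continuous F}.
  by move=> /dF [dFx _]; exact/differentiable_continuous/derivable1_diffP.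
rewrite (@continuous_FTC2 _ g F)//.
- exact: within_continuous_itv.
- split.
  + move=> x /[!in_itv]/= /andP[ax _].
    by have [] := dF _ (lt_trans a0 ax).
  + by apply: cvg_at_right_filter; exact: cF.
  + by apply: cvg_at_left_filter; apply: cF; exact: lt_trans ab.
- move=> x /[!in_itv]/= /andP[ax _].
  by have [_ <-] := dF _ (lt_trans a0 ax); rewrite derive1E.
Qed.

Lemma measurable_powR_pos a : measurable_fun (@Rpos R) (fun x : R => x `^ a).
Proof. by apply: measurable_fun_Rpos => x; exact: continuous_powR_pos. Qed.

Lemma measurable_energy mu f g h : measurable_fun Rpos f ->
  measurable_fun Rpos g -> measurable_fun Rpos h ->
  measurable_fun Rpos (fun x => energy mu x (f x) (g x) (h x)).
Proof.
move=> mf mg mh; have mp := measurable_powR_pos.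
have D k l := @measurable_funD _ _ R (@Rpos R) k l.
have M k l := @measurable_funM _ _ R (@Rpos R) k l.
have sq (k : R -> R) : measurable_fun Rpos k ->
    measurable_fun Rpos (fun x => k x ^+ 2) by move=> mk; exact: M.
have e1 := M _ _ (mp (mu + 1)) (sq _ mh).
have e2 := M _ _ (D _ _ (mp (mu + 1)) (mp (mu - 1))) (sq _ mg).
exact: (D _ _ (D _ _ e1 e2) (M _ _ (mp (mu - 1)) (sq _ mf))).
Qed.

Lemma measurable_defect mu lam c f g h : measurable_fun Rpos f ->
  measurable_fun Rpos g -> measurable_fun Rpos h ->
  measurable_fun Rpos (fun x => defect mu lam c x (f x) (g x) (h x)).
Proof.
move=> mf mg mh; have mp := measurable_powR_pos.
have cst a : measurable_fun (@Rpos R) (fun=> a : R) by exact: measurable_cst.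
have id : measurable_fun Rpos (fun x : R => x) by exact: measurable_id.
have D k l := @measurable_funD _ _ R (@Rpos R) k l.
have M k l := @measurable_funM _ _ R (@Rpos R) k l.
have B k l := @measurable_funB _ _ R (@Rpos R) k l.
have sq (k : R -> R) : measurable_fun Rpos k ->
    measurable_fun Rpos (fun x => k x ^+ 2) by move=> mk; exact: M.
have l := D _ _ (D _ _ (D _ _ (M _ _ id mh) (M _ _ (M _ _ (cst lam) id) mg))
  (M _ _ (cst mu) mg)) (M _ _ (cst (lam * c)) mf).
have q1 := B _ _ (M _ _ (sq _ id) (sq _ mg))
  (M _ _ (cst (c * (mu - c))) (sq _ mf)).
have q2 := M _ _ (cst (lam ^+ 2)) (M _ _ q1 (mp (mu - 1))).
have q3 := M _ _ (cst (lam * (2 * c - mu + 1))) (M _ _ (sq _ mg) (mp mu)).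
have q4 := M _ _ (sq _ mh) (mp (mu + 1)).
exact: (B _ _ (M _ _ (sq _ l) (mp (mu - 1))) (D _ _ (B _ _ q2 q3) q4)).
Qed.

Lemma integrable_defect mu lam c f g h :
  measurable_fun Rpos f -> measurable_fun Rpos g -> measurable_fun Rpos h ->
  leb.-integrable Rpos (EFin \o fun x => energy mu x (f x) (g x) (h x)) ->
  leb.-integrable Rpos (EFin \o fun x => defect mu lam c x (f x) (g x) (h x)).
Proof.
move=> mf mg mh ie; have [K K0 HK] := @defect_bound R mu lam c.
have mR := @measurable_Rpos R.
have iKe := @integrableZl _ _ R leb Rpos mR K _ ie.
apply: (@le_integrable _ _ R leb Rpos mR _ _ _ _ iKe).
  by apply/measurable_EFinP; exact: measurable_defect.
move=> x /RposE x0 /=; rewrite lee_fin.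
by rewrite (le_trans (HK _ _ _ _ x0))// ler_norm.
Qed.

Lemma nbhs_infty_gtr_add (x : R) m : \forall n \near \oo, x < (m + n)%:R.
Proof.
near=> n; apply: (@lt_le_trans _ _ n%:R); last by rewrite ler_nat leq_addl.
by near: n; exact: nbhs_infty_gtr.
Unshelve. all: by end_near. Qed.

Lemma integral_defect_eq0 mu lam c u v w :
  (forall x, 0 < x -> is_derive x 1 u (v x)) ->
  (forall x, 0 < x -> is_derive x 1 v (w x)) ->
  (forall x, 0 < x -> {for x, continuous w}) ->
  leb.-integrable Rpos (EFin \o fun x => energy mu x (u x) (v x) (w x)) ->
  \int[leb]_(x in Rpos) defect mu lam c x (u x) (v x) (w x) = 0.
Proof.
move=> du dv cw ie.
have cu (x : R) : 0 < x -> {for x, continuous u}.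
  by move=> /du [d _]; exact/differentiable_continuous/derivable1_diffP.
have cv (x : R) : 0 < x -> {for x, continuous v}.
  by move=> /dv [d _]; exact/differentiable_continuous/derivable1_diffP.
pose e x := energy mu x (u x) (v x) (w x).
pose d x := defect mu lam c x (u x) (v x) (w x).
pose G x := defect_primitive mu lam c x (u x) (v x).
have ce x : 0 < x -> {for x, continuous e}.
  by move=> x0; apply: continuous_energy; auto.
have cd x : 0 < x -> {for x, continuous d}.
  by move=> x0; apply: continuous_defect; auto.
have dG x : 0 < x -> is_derive x 1 G (d x).
  by move=> x0; apply: is_derive_defect_primitive; auto.
have e0 x : 0 < x -> 0 <= e x by move=> _; exact: energy_ge0.
have [K K0 HK] := @defect_primitive_bound R mu lam c.
have GK (y_ : nat -> R) : (forall n, 0 < y_ n) ->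
    y_ n * e (y_ n) @[n --> \oo] --> 0 -> G (y_ n) @[n --> \oo] --> 0.
  by move=> y0; apply: cvg_norm_le0 => n; exact: HK.
(* Windows shrinking to 0 give the left endpoints. *)
have [a_ aT a0] : exists2 a_ : nat -> R,
    forall n, n.+1%:R^-1 <= a_ n <= 2 * n.+1%:R^-1 &
    a_ n * e (a_ n) @[n --> \oo] --> 0.
  apply: window_cvg0 => // x x0; near=> n.
  apply/negP; rewrite negb_and -!ltNge; apply/orP; right.
  rewrite ltr_pdivrMr ?ltr0n// mulrC -ltr_pdivrMr//.
  near: n; exact: (nbhs_infty_gtr_add _ 1).
(* Windows going to +oo give the right endpoints. The shift by 3 ensures 2 / (n + 1) < n + 3 already
   at n = 0, hence a_n < b_n for all n. *)
have [b_ bT b0] : exists2 b_ : nat -> R,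
    forall n, n.+3%:R <= b_ n <= 2 * n.+3%:R &
    b_ n * e (b_ n) @[n --> \oo] --> 0.
  apply: window_cvg0 => // x x0; near=> n.
  apply/negP; rewrite negb_and -!ltNge; apply/orP; left.
  near: n; exact: (nbhs_infty_gtr_add _ 3).
have a_gt0 n : 0 < a_ n.
  by have /andP[+ _] := aT n; apply: lt_le_trans; rewrite invr_gt0.
have ab n : a_ n < b_ n.
  have /andP[_ h1] := aT n; have /andP[h2 _] := bT n.
  apply: le_lt_trans h1 (lt_le_trans _ h2).
  rewrite ltr_pdivrMr// -natrM ltr_nat.
  by rewrite mulnS addnC ltn_addl.
(* The integral is G(b_n) - G(a_n), and both boundary values tend to 0. *)
have cv1 : \int[leb]_(x in `[a_ n, b_ n]) d x @[n --> \oo] --> (0 : R).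
  rewrite -[X in _ --> X](subr0 0).
  under eq_fun do rewrite (Rintegral_itv_is_derive G)//.
  apply: cvgB; apply: GK => // n; exact: lt_trans (ab n).
(* The same integrals tend to the full one, since every positive point eventually lies in
   [a_n, b_n]. *)
have cv2 : \int[leb]_(x in `[a_ n, b_ n]) d x @[n --> \oo] -->
    \int[leb]_(x in Rpos) d x.
  apply: (@cvg_Rintegral_subset _ _ _ leb Rpos) => //.
  - exact: measurable_Rpos.
  - exact: measurable_Rpos.
  - by move=> n; exact: itv_sub_Rpos.
  - by apply: integrable_defect => //; apply: measurable_fun_Rpos; auto.
  move=> x /RposE x0; near=> n; split => [_|_]; first exact/RposE.
  rewrite /= in_itv/=; apply/andP; split.
    have /andP[_] := aT n; move=> /le_trans; apply.
    rewrite ler_pdivrMr ?ltr0n// mulrC -ler_pdivrMr//.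
    apply: ltW; near: n; exact: (nbhs_infty_gtr_add _ 1).
  have /andP[+ _] := bT n; apply: le_trans.
  apply: ltW; near: n; exact: (nbhs_infty_gtr_add _ 3).
exact: (cvg_unique _ cv2 cv1).
Unshelve. all: by end_near. Qed.

End SmoothIdentity.

(** * Passage to the completion *)

Section Completion.
Context {R : realType}.
Implicit Types (f g h u v w : R -> R) (mu lam c e x : R).
Local Notation leb := (@lebesgue_measure R).
Local Notation en mu f g h := (fun x => energy mu x (f x) (g x) (h x)).

Lemma le_integrable_Rpos (k l : R -> R) : measurable_fun Rpos k ->
  leb.-integrable Rpos (EFin \o l) -> (forall x, 0 < x -> `|k x| <= l x) ->
  leb.-integrable Rpos (EFin \o k).
Proof.
move=> mk il kl; apply: (@le_integrable _ _ R leb Rpos _ _ _ _ _ il).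
- exact: measurable_Rpos.
- exact/measurable_EFinP.
- by move=> x /RposE x0 /=; rewrite lee_fin (le_trans (kl _ x0))// ler_norm.
Qed.

Lemma integrableZ_Rpos a (k : R -> R) : leb.-integrable Rpos (EFin \o k) ->
  leb.-integrable Rpos (EFin \o (fun x => a * k x)).
Proof.
by move=> ik; exact: (@integrableZl _ _ R leb Rpos measurable_Rpos a _ ik).
Qed.

Lemma integrableD_Rpos (k l : R -> R) : leb.-integrable Rpos (EFin \o k) ->
  leb.-integrable Rpos (EFin \o l) ->
  leb.-integrable Rpos (EFin \o (fun x => k x + l x)).
Proof.
by move=> ik il; exact: (@integrableD _ _ R leb Rpos measurable_Rpos _ _ ik il).
Qed.

Lemma RintegralZ_Rpos a (k : R -> R) : leb.-integrable Rpos (EFin \o k) ->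
  \int[leb]_(x in Rpos) (a * k x) = a * \int[leb]_(x in Rpos) k x.
Proof. by move=> ik; rewrite RintegralZl//; exact: measurable_Rpos. Qed.

Lemma RintegralD_Rpos (k l : R -> R) : leb.-integrable Rpos (EFin \o k) ->
  leb.-integrable Rpos (EFin \o l) -> \int[leb]_(x in Rpos) (k x + l x) =
    \int[leb]_(x in Rpos) k x + \int[leb]_(x in Rpos) l x.
Proof. by move=> ik il; rewrite RintegralD//; exact: measurable_Rpos. Qed.

(** Write f = u - (u - f), likewise for [g] and [h], and apply [energy_triangle]. *)
Lemma integrable_energy_approx mu f g h u v w :
  measurable_fun Rpos f -> measurable_fun Rpos g -> measurable_fun Rpos h ->
  leb.-integrable Rpos (EFin \o en mu u v w) ->
  leb.-integrable Rpos (EFin \o en mu (u \- f) (v \- g) (w \- h)) ->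
  leb.-integrable Rpos (EFin \o en mu f g h).
Proof.
move=> mf mg mh iu iuf.
apply: (@le_integrable_Rpos _
  (fun x => 2 * en mu u v w x + 2 * en mu (u \- f) (v \- g) (w \- h) x)).
- exact: measurable_energy.
- by apply: integrableD_Rpos; exact: integrableZ_Rpos.
- move=> x x0; rewrite ger0_norm ?energy_ge0//=.
  have := @energy_triangle R mu x (u x) (v x) (w x) (u x - f x) (v x - g x)
    (w x - h x).
  by rewrite !opprB !(addrC _ (_ - _)) !subrK.
Qed.

(** Integrated form of [defect_perturb] around the limit (f, g, h): [d] multiplies the fixed energy
    of the limit, and the large factor multiplies the energy of the difference. *)
Lemma Rintegral_defect_dist mu lam c : exists2 K, 0 <= K &
  forall f g h u v w d, 0 < d ->
  measurable_fun Rpos f -> measurable_fun Rpos g -> measurable_fun Rpos h ->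
  measurable_fun Rpos u -> measurable_fun Rpos v -> measurable_fun Rpos w ->
  leb.-integrable Rpos (EFin \o en mu u v w) ->
  leb.-integrable Rpos (EFin \o en mu (u \- f) (v \- g) (w \- h)) ->
  `|\int[leb]_(x in Rpos) defect mu lam c x (u x) (v x) (w x)
    - \int[leb]_(x in Rpos) defect mu lam c x (f x) (g x) (h x)| <=
  K * (d * \int[leb]_(x in Rpos) en mu f g h x
    + (d^-1 + 1) * \int[leb]_(x in Rpos) en mu (u \- f) (v \- g) (w \- h) x).
Proof.
have [K K0 HK] := @defect_perturb R mu lam c; exists K => //.
move=> f g h u v w d d0 mf mg mh m_u mv mw iu iuf.
have i_f := integrable_energy_approx _ _ _ _ _ _ _ mf mg mh iu iuf.
have idf := integrable_defect mu lam c _ _ _ mf mg mh i_f.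
have idu := integrable_defect mu lam c _ _ _ m_u mv mw iu.
have mR := @measurable_Rpos R.
rewrite -RintegralB//.
have idB : leb.-integrable Rpos (EFin \o (fun x =>
  defect mu lam c x (u x) (v x) (w x) - defect mu lam c x (f x) (g x) (h x))).
  exact: (@integrableB _ _ R leb Rpos mR _ _ idu idf).
apply: (le_trans (le_normr_Rintegral _ idB)) => //.
have ib1 := integrableZ_Rpos d _ i_f.
have ib2 := integrableZ_Rpos (d^-1 + 1) _ iuf.
rewrite -(RintegralZ_Rpos d)// -(RintegralZ_Rpos (d^-1 + 1))//.
rewrite -RintegralD_Rpos// -RintegralZ_Rpos; last exact: integrableD_Rpos.
apply: le_Rintegral => //.
- exact: integrable_norm.
- by apply: integrableZ_Rpos; exact: integrableD_Rpos.
- move=> x /RposE x0.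
  have := HK d x (f x) (g x) (h x) (u x - f x) (v x - g x) (w x - h x) d0 x0.
  by rewrite !(addrC _ (_ - _)) !subrK.
Qed.

(** Passage from the extended-real norm to a real integral: the bound makes the energy integrable,
    so that [fine] preserves its integral. The square root matches the exponent 1/2 in [enorm]. *)
Lemma enorm_lt mu f f2 e : 0 < e -> measurable_fun Rpos f ->
  measurable_fun Rpos (derive1 f) -> measurable_fun Rpos f2 ->
  (enorm mu f f2 < (Num.sqrt e)%:E)%E ->
  leb.-integrable Rpos (EFin \o en mu f (derive1 f) f2) /\
  \int[leb]_(x in Rpos) en mu f (derive1 f) f2 x < e.
Proof.
move=> e0 mf mg mh; rewrite /enorm.
set I := (X in (X `^ _ < _)%E).
have I0 : (0 <= I)%E.
  by apply: integral_ge0 => x _; rewrite lee_fin; exact: energy_ge0.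
move=> Ie.
have Ioo : (I < +oo)%E.
  by apply: (@lty_poweRy _ _ 2^-1) => //; apply: lt_trans Ie _; rewrite ltry.
have Ifin : I \is a fin_num by rewrite ge0_fin_numE.
split.
  apply/integrableP; split.
    by apply/measurable_EFinP; exact: measurable_energy.
  apply: le_lt_trans Ioo; rewrite le_eqVlt; apply/orP; left; apply/eqP.
  by apply: eq_integral => x _ /=; rewrite ger0_norm ?energy_ge0.
rewrite -[ltLHS]/(fine I).
have f0 : 0 <= fine I by exact: fine_ge0.
rewrite -(fineK Ifin) poweR_EFin lte_fin powR12_sqrt// ltr_sqrt// in Ie.
Qed.

Lemma smooth_on_is_derive u n x : smooth_on Rpos u -> 0 < x ->
  is_derive x 1 (derive1n n u) (derive1n n.+1 u x).
Proof.
move=> su x0; rewrite derive1nS derive1E; apply: DeriveDef => //.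
by apply: su; exact/RposE.
Qed.

Lemma C1_on_continuous f x : C1_on Rpos f -> 0 < x ->
  {for x, continuous f} /\ {for x, continuous (derive1 f)}.
Proof.
move=> cf /RposE /cf [df cdf]; split => //.
exact/differentiable_continuous/derivable1_diffP.
Qed.

(** The integrated defect is zero for each smooth approximant, and [Rintegral_defect_dist] transfers
    this to the limit. *)
Lemma Ebar_integral_defect_eq0 mu f f2 : C1_on Rpos f ->
  measurable_fun Rpos f2 -> (exists u : nat -> R -> R,
    (forall n, E_space mu (u n)) /\
    enorm mu (u n \- f) (derive1n 2 (u n) \- f2) @[n --> \oo] --> 0%E) ->
  leb.-integrable Rpos (EFin \o en mu f (derive1 f) f2) /\
  forall lam c,
    \int[leb]_(x in Rpos) defect mu lam c x (f x) (derive1 f x) (f2 x) = 0.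
Proof.
move=> cf mf2 [u [Eu cvu]].
have mf : measurable_fun Rpos f.
  by apply: measurable_fun_Rpos => x /(C1_on_continuous _ _ cf)[].
have mf1 : measurable_fun Rpos (derive1 f).
  by apply: measurable_fun_Rpos => x /(C1_on_continuous _ _ cf)[].
have cu n m x : 0 < x -> {for x, continuous (derive1n m (u n))}.
  move=> /RposE Rx; apply/differentiable_continuous/derivable1_diffP.
  by have [su _] := Eu n; exact: su.
have m_u n m : measurable_fun Rpos (derive1n m (u n)).
  by apply: measurable_fun_Rpos; exact: cu.
have iu n : leb.-integrable Rpos (EFin \o
    en mu (u n) (derive1 (u n)) (derive1n 2 (u n))).
  have [_ fin_u] := Eu n.
  have [r r0 ur] : exists2 r : R, 0 < r &
      (enorm mu (u n) (derive1n 2 (u n)) < (Num.sqrt r)%:E)%E.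
    have u0 : (0 <= enorm mu (u n) (derive1n 2 (u n)))%E by exact: poweR_ge0.
    (* Its square root exceeds the norm by 1. *)
    exists ((fine (enorm mu (u n) (derive1n 2 (u n))) + 1) ^+ 2).
      by rewrite exprn_gt0// ltr_wpDl// fine_ge0.
    rewrite sqrtr_sqr ger0_norm ?addr_ge0 ?fine_ge0//.
    by rewrite -[X in (X < _)%E]fineK ?ge0_fin_numE// lte_fin ltrDl.
  by have [] := enorm_lt _ _ _ _ r0 (m_u n 0%N) (m_u n 1%N) (m_u n 2%N) ur.
(* Differentiability is known at positive points only, so the two forms of the derivative are
   exchanged under integrals over [Rpos]. *)
have du n x : 0 < x -> derive1 (u n \- f) x = derive1 (u n) x - derive1 f x.
  move=> /RposE Rx; have [dfx _] := cf x Rx; have [su _] := Eu n.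
  by rewrite !derive1E deriveB//; exact: (su 0%N).
have approx e : 0 < e -> exists n, leb.-integrable Rpos (EFin \o
      en mu (u n \- f) (derive1 (u n) \- derive1 f) (derive1n 2 (u n) \- f2)) /\
    \int[leb]_(x in Rpos)
      en mu (u n \- f) (derive1 (u n) \- derive1 f) (derive1n 2 (u n) \- f2) x
    < e.
  move=> e0.
  pose N n := enorm mu (u n \- f) (derive1n 2 (u n) \- f2).
  have [n Hn] : exists n, (N n < (Num.sqrt e)%:E)%E.
    have /cvu : nbhs (0%E : \bar R) [set y | (y < (Num.sqrt e)%:E)%E].
      by apply: open_nbhs_nbhs; split;
        [exact: open_ereal_lt_ereal|rewrite /= lte_fin sqrtr_gt0].
    by case=> n _ Hn; exists n; exact: (Hn n (leqnn n)).
  exists n.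
  have eqd x : Rpos x -> derive1 (u n) x - derive1 f x = derive1 (u n \- f) x.
    by move=> /RposE x0; rewrite du.
  have mB g h : measurable_fun Rpos g -> measurable_fun Rpos h ->
    measurable_fun Rpos (g \- h) by exact: measurable_funB.
  have [] := enorm_lt _ _ _ _ e0 (mB _ _ (m_u n 0%N) mf) _
    (mB _ _ (m_u n 2%N) mf2) Hn.
    apply: eq_measurable_fun (mB _ _ (m_u n 1%N) mf1) => x /[!inE] Rx.
    exact: eqd.
  move=> i1 i2; split.
    apply: eq_integrable i1; first exact: measurable_Rpos.
    by move=> x /[!inE] Rx /=; rewrite -eqd.
  rewrite (_ : Rintegral _ _ _ = \int[leb]_(x in Rpos)
    en mu (u n \- f) (derive1 (u n \- f)) (derive1n 2 (u n) \- f2) x)//.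
  by apply: eq_Rintegral => x /[!inE] Rx; rewrite -eqd.
have i_f : leb.-integrable Rpos (EFin \o en mu f (derive1 f) f2).
  have [n [+ _]] := approx _ ltr01.
  exact: integrable_energy_approx.
split=> // lam c.
have [K K0 HK] := Rintegral_defect_dist mu lam c.
set D := Rintegral _ _ _.
set E := \int[leb]_(x in Rpos) en mu f (derive1 f) f2 x.
have bound d e : 0 < d -> 0 < e -> `|D| <= K * (d * E + (d^-1 + 1) * e).
  move=> d0 /approx [n [i1 i2]].
  have := HK _ _ _ _ _ _ _ d0 mf mf1 mf2 (m_u n 0%N) (m_u n 1%N) (m_u n 2%N)
    (iu n) i1.
  have sun : smooth_on Rpos (u n) by have [] := Eu n.
  have du0 x : 0 < x -> is_derive x 1 (u n) (derive1 (u n) x).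
    exact: (smooth_on_is_derive (u n) 0%N).
  have du1 x : 0 < x -> is_derive x 1 (derive1 (u n)) (derive1n 2 (u n) x).
    exact: (smooth_on_is_derive (u n) 1%N).
  rewrite (integral_defect_eq0 mu lam c _ _ _ du0 du1 (cu n 2%N) (iu n)).
  rewrite sub0r normrN => /le_trans; apply; apply: ler_wpM2l => //.
  apply: lerD => //; apply: ler_wpM2l; last exact: ltW.
  by rewrite addr_ge0 ?invr_ge0 ?(ltW d0).
have E0 : 0 <= E by apply: Rintegral_ge0 => x _; exact: energy_ge0.
apply/eqP; rewrite -normr_eq0; apply/eqP/le_anti; rewrite normr_ge0 andbT.
apply/ler_addgt0Pl => e e0; rewrite addr0.
have KE : 0 < (K + 1) * (E + 1) by rewrite mulr_gt0 ?ltr_wpDl.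
(* First [d] makes K d E at most e / 2; then the approximation error is chosen, depending on [d], to
   do the same for the other term. Adding 1 to [K] and [E] keeps the denominators positive. *)
pose d := e / 2 / ((K + 1) * (E + 1)).
have d0 : 0 < d by rewrite !divr_gt0.
have d1 : 0 < (K + 1) * (d^-1 + 1).
  by rewrite mulr_gt0 ?ltr_wpDl// invr_ge0 ltW.
have e'0 : 0 < e / 2 / ((K + 1) * (d^-1 + 1)) by rewrite !divr_gt0.
apply: (le_trans (bound _ _ d0 e'0)); rewrite mulrDr [leRHS]splitr.
apply: lerD.
  have -> : e / 2 = (K + 1) * (d * (E + 1)).
    by rewrite /d; field; rewrite !gt_eqF ?ltr_wpDl.
  apply: ler_pM => //; first exact: mulr_ge0 (ltW d0) E0.
    by rewrite lerDl.
  by rewrite ler_pM2l// lerDl.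
rewrite mulrA.
apply: (@le_trans _ _
  ((K + 1) * (d^-1 + 1) * (e / 2 / ((K + 1) * (d^-1 + 1))))).
  apply: ler_wpM2r; first exact: ltW.
  by rewrite ler_pM2r ?lerDl// ltr_wpDl// invr_ge0 ltW.
by rewrite mulrC divfK// gt_eqF.
Qed.

End Completion.

(** * Uniqueness of weak derivatives *)

Section FlatFunctions.
Context {R : realType}.
Implicit Types (p w : {poly R}) (x y t : R) (m n : nat).

(* For a fixed w these functions form a class stable under derivation, hence they
   are smooth. *)
Definition flat p w m x : R :=
  if 0 < w.[x] then p.[x] * (w.[x]^-1 ^+ m * expR (- w.[x]^-1)) else 0.

(** The numerator of the derivative of p w^(-m) exp(-1/w) over w^(m+2). *)
Definition flat_deriv p w m : {poly R} :=
  p^`() * w ^+ 2 - p * w^`() * w *+ m + p * w^`().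

(** With y = 1/t, this is exp(y) >= y^(m+2) / (m+2)!. *)
Lemma exprV_expRN_le m t : 0 < t ->
  t^-1 ^+ m * expR (- t^-1) <= (m.+2)`!%:R * t ^+ 2.
Proof.
move=> t0; have y0 : 0 < t^-1 by rewrite invr_gt0.
rewrite -[in leRHS](invrK t); move: (t^-1) y0 => y y0.
have N0 : 0 < (m.+2)`!%:R :> R by rewrite ltr0n fact_gt0.
rewrite expRN ler_pdivrMr ?expR_gt0// exprVn mulrAC ler_pdivlMr ?exprn_gt0//.
rewrite -exprD addn2 mulrC -ler_pdivrMr//.
by apply: le_trans (expR_ge1Dxn m.+1 (ltW y0)); rewrite lerDr.
Qed.

(** The difference quotient is at most |A(x + h)| |h|, which tends to 0 by continuity of [A]. *)
Lemma is_derive0_quadratic (F A : R -> R) x : F x = 0 ->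
  {for x, continuous A} -> (forall y, `|F y| <= `|A y| * (y - x) ^+ 2) ->
  is_derive x 1 F 0.
Proof.
move=> Fx cA FA.
have cv : h^-1 *: ((F \o shift x) (h *: (1 : R)) - F x) @[h --> (0 : R)^'] -->
    (0 : R).
  apply: norm_cvg0.
  have cv0 : `|A (h + x)| * `|h| @[h --> (0 : R)^'] --> (0 : R).
    rewrite -[X in _ --> X](mulr0 `|A x|) -[X in _ --> `|A x| * X](@normr0 R R).
    apply: cvgM; apply: cvg_norm; last exact: nbhs_dnbhs.
    have : (h + x) @[h --> (0 : R)^'] --> x.
      rewrite -[X in _ --> X]add0r; apply: cvgD; last exact: cvg_cst.
      exact: nbhs_dnbhs.
    by move=> /cvg_comp; apply; exact: cA.
  apply: (squeeze_cvgr _ (@cvg_cst _ 0 _ _ _) cv0).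
  near=> h; rewrite normr_ge0 /= Fx subr0.
  have h0 : h != 0 by near: h; exact: nbhs_dnbhs_neq.
  rewrite /GRing.scale /= mulr1 normrM normfV ler_pdivrMl ?normr_gt0//.
  rewrite mulrCA -expr2 real_normK ?num_real//.
  by have := FA (h + x); rewrite addrK.
by apply: DeriveDef; [apply/cvg_ex; exists 0|exact: cvg_lim cv].
Unshelve. all: by end_near. Qed.

(** Let w - w(x) = q (X - x). Where w(y) > 0, w(y) is at most q(y) (y - x) because w(x) <= 0, and
    [exprV_expRN_le] gives the quadratic bound; elsewhere the function is 0. *)
Lemma flat_quadratic p w m x : w.[x] <= 0 -> exists q : {poly R},
  forall y, `|flat p w m y| <= `|q.[y]| * (y - x) ^+ 2.
Proof.
move=> wx; have /factor_theorem[q qE] : root (w - w.[x]%:P) x.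
  by rewrite /root !hornerE subrr.
exists (p * q ^+ 2 * (m.+2)`!%:R%:P) => y.
rewrite /flat; case: ifPn => [wy|_]; last first.
  by rewrite normr0 mulr_ge0 ?sqr_ge0.
have wE : w.[y] - w.[x] = q.[y] * (y - x).
  by rewrite -[w.[x]](hornerC _ y) -hornerN -hornerD qE !hornerE.
have N0 : 0 <= (m.+2)`!%:R :> R by rewrite ler0n.
have qq : `|q.[y]| * `|q.[y]| = q.[y] ^+ 2.
  by rewrite -normrM -expr2 ger0_norm ?sqr_ge0.
rewrite !hornerM hornerC !normrM (ger0_norm N0) qq [leRHS](_ : _ =
  `|p.[y]| * ((m.+2)`!%:R * (q.[y] * (y - x)) ^+ 2)); last by ring.
apply: ler_wpM2l => //.
rewrite (ger0_norm (expR_ge0 _)) ger0_norm ?exprn_ge0 ?invr_ge0 ?(ltW wy)//.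
apply: (le_trans (exprV_expRN_le m _ wy)); rewrite -wE.
rewrite ler_wpM2l// ler_sqr ?nnegrE ?(ltW wy)// ?subr_ge0.
  by rewrite lerBrDr gerDl.
exact: le_trans wx (ltW wy).
Qed.

(** Where w(x) <= 0, zeros of [w] included, the quadratic bound gives derivative 0. Where w(x) > 0
    the usual rules apply to the formula, which holds near [x]. *)
Lemma is_derive_flat p w m x :
  is_derive x 1 (flat p w m) (flat (flat_deriv p w m) w m.+2 x).
Proof.
have [wx|wx] := ltP 0 w.[x]; last first.
  have [q qP] := flat_quadratic p w m x wx.
  rewrite [flat _ _ _ x]/flat ltNge wx /=.
  apply: (is_derive0_quadratic _ (horner q)) => //.
    by rewrite /flat ltNge wx.
  exact: continuous_horner.
have dp := is_derive_poly p x; have dw := is_derive_poly w x.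
have w0 : w.[x] != 0 by rewrite gt_eqF.
have dV := is_deriveV w0 dw.
have dE := @is_derive1_comp R expR (- (fun y : R => w.[y]^-1)) x _ _
  (is_derive_expR _) (is_deriveN dV).
have dX := is_deriveX m dV.
have d := is_deriveM dp (is_deriveM dX dE).
apply: (@near_eq_is_derive _ _ _ (fun y =>
  p.[y] * (w.[y]^-1 ^+ m * expR (- w.[y]^-1)))).
  have /cvgr_gt : w.[y] @[y --> x] --> w.[x] by exact: continuous_horner.
  by move=> /(_ _ wx); apply: filterS => y wy; rewrite /flat wy.
have -> : (fun y => p.[y] * (w.[y]^-1 ^+ m * expR (- w.[y]^-1))) =
    horner p * ((fun y => w.[y]^-1) ^+ m * (expR \o - (fun y => w.[y]^-1))).
  by apply/funext => y; rewrite [RHS]/= -[_ y in RHS]/(_ * (_ * _)) exprfctE.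
move: d => /is_derive_eq; apply.
rewrite /flat wx /flat_deriv !hornerD hornerN hornerMn !hornerM -expr2.
move: (p.[x]) (p^`().[x]) (w^`().[x]) => P P' W'.
have key Z : Z = w.[x]^-1 ^+ m ->
  P * (Z * (expR (- w.[x]^-1) * - (- w.[x] ^- 2 * W'))
    + expR (- w.[x]^-1) * (m%:R * w.[x]^-1 ^+ m.-1 * (- w.[x] ^- 2 * W')))
    + Z * expR (- w.[x]^-1) * P' =
  (P' * w.[x] ^+ 2 - P * W' * w.[x] *+ m + P * W')
    * (w.[x]^-1 ^+ m.+2 * expR (- w.[x]^-1)).
  move=> ->; move: (expR (- w.[x]^-1)) (w.[x]) w0 => E W W0; rewrite -mulr_natr.
  (* The exponent [m.-1] forces a separate case m = 0. *)
  by case: m {dX} => [|k] /=; rewrite ?exprS ?expr0; [|move: (W^-1 ^+ k) => U];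
    field.
by apply: key; rewrite exprfctE.
Qed.

End FlatFunctions.

(** * Bump functions approximating the indicator of an interval *)

Section Bumps.
Context {R : realType}.
Implicit Types (a b x y : R) (n : nat).
Local Notation leb := (@lebesgue_measure R).

Lemma smooth_flat (p w : {poly R}) m : smooth_on setT (flat p w m).
Proof.
have D n : exists q k, derive1n n (flat p w m) = flat q w k.
  elim: n => [|n [q [k IH]]]; first by exists p, m.
  exists (flat_deriv q w k), k.+2; rewrite derive1nS IH; apply/funext => x.
  rewrite derive1E.
  exact: (@derive_val _ _ _ _ _ _ _ (is_derive_flat q w k x)).
move=> n x _; have [q [k ->]] := D n.
exact: (@ex_derive _ _ _ _ _ _ _ (is_derive_flat q w k x)).
Qed.

(** exp(-1/w) for w = (n + 1) (x - a) (b - x), which for a < b is positive exactly on ]a, b[. The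
    growing factor n + 1 makes the values there tend to 1. *)
Definition bump a b n : R -> R :=
  flat 1 (n.+1%:R *: (('X - a%:P) * (b%:P - 'X))) 0.

Lemma bumpE a b n x : bump a b n x =
  if 0 < (x - a) * (b - x)
  then expR (- (n.+1%:R * ((x - a) * (b - x)))^-1) else 0.
Proof.
rewrite /bump /flat -polyC1 hornerC expr0 !mul1r hornerZ hornerM !hornerD.
by rewrite !hornerN !hornerX !hornerC pmulr_rgt0// ltr0n.
Qed.

Lemma bump_range a b n x : 0 <= bump a b n x <= 1.
Proof.
rewrite bumpE; case: ifP => [w0|_]; last by rewrite lexx ler01.
by rewrite expR_ge0 expR_le1 oppr_le0 invr_ge0 mulr_ge0 ?(ltW w0).
Qed.

Lemma bump_in a b n x : a < x < b ->
  bump a b n x = expR (- (n.+1%:R * ((x - a) * (b - x)))^-1).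
Proof.
by move=> /andP[ax xb]; rewrite bumpE mulr_gt0 ?subr_gt0.
Qed.

Lemma bump_out a b n x : a < b -> ~~ (a < x < b) -> bump a b n x = 0.
Proof.
move=> ab axb; rewrite bumpE ltNge; case: ifPn => //; case/negP.
have [ax|xa] := ltP a x.
  rewrite mulr_ge0_le0 ?subr_ge0 ?subr_le0 ?(ltW ax)//.
  by rewrite leNgt (contra _ axb)// ax.
by rewrite mulr_le0_ge0 ?subr_ge0 ?subr_le0// (le_trans xa)// ltW.
Qed.

Lemma test_function_bump a b n : 0 < a -> a < b -> test_function (bump a b n).
Proof.
move=> a0 ab; split; first exact: smooth_flat.
exists a, b; split => // x; apply: contra_neqT => axb; apply: bump_out => //.
by apply: contra axb => /andP[/ltW -> /ltW ->].
Qed.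

Lemma cvg_bump a b x : a < b ->
  bump a b n x @[n --> \oo] --> (\1_(`]a, b[%classic) x : R).
Proof.
move=> ab; rewrite indicE; have [axb|axb] := boolP (a < x < b); last first.
  rewrite memNset /=; last by rewrite in_itv/=; apply/negP.
  by under eq_fun do rewrite bump_out//; exact: cvg_cst.
rewrite mem_set /=; last by rewrite in_itv.
have cv0 : - (n.+1%:R * ((x - a) * (b - x)))^-1 @[n --> \oo] --> (0 : R).
  rewrite -oppr0; apply: cvgN.
  rewrite -[X in _ --> X](mul0r ((x - a) * (b - x))^-1).
  under eq_fun do rewrite invfM.
  exact: (cvgM cvg_harmonic (cvg_cst _)).
rewrite -[X in _ --> X](@expR0 R); under eq_fun do rewrite bump_in//.
exact: (cvg_comp _ _ cv0 (@continuous_expR R 0)).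
Qed.

Lemma continuous_bump a b n : continuous (bump a b n).
Proof.
move=> x; apply/differentiable_continuous/derivable1_diffP.
exact: (@smooth_flat _ _ _ 0%N).
Qed.

Lemma locally_integrable_itv (g : R -> R) a b : 0 < a ->
  locally_integrable Rpos g -> leb.-integrable `[a, b] (EFin \o g).
Proof.
move=> a0 [mg _ ig]; apply/integrableP; split.
  apply/measurable_EFinP; apply: measurable_funS mg.
    exact: measurable_Rpos.
  exact: itv_sub_Rpos.
by apply: ig; [exact: itv_sub_Rpos|exact: segment_compact].
Qed.

Lemma Rintegral_bump (g : R -> R) a b n : 0 < a -> a < b ->
  \int[leb]_(x in Rpos) (g x * bump a b n x) =
  \int[leb]_(x in `[a, b]) (g x * bump a b n x).
Proof.
move=> a0 ab.
rewrite -[X in _ = Rintegral _ X _](setIidr (@itv_sub_Rpos R a b a0)).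
rewrite Rintegral_mkcondr; apply: eq_Rintegral => x _.
rewrite patchE; case: ifPn => // xab; rewrite bump_out ?mulr0//.
apply: contra xab => /andP[ax xb].
by rewrite inE /= in_itv/= (ltW ax) (ltW xb).
Qed.

Lemma integrable_bump (g : R -> R) a b n : 0 < a ->
  locally_integrable Rpos g ->
  leb.-integrable `[a, b] (EFin \o (fun x => g x * bump a b n x)).
Proof.
move=> a0 lg; have ig := locally_integrable_itv _ _ b a0 lg.
have mitv : measurable (`[a, b]%classic : set R) by exact: measurable_itv.
apply: (@le_integrable _ _ R leb _ mitv _ _ _ _ ig).
  apply/measurable_EFinP; apply: measurable_funM.
    by have /integrableP[/measurable_EFinP] := ig.
  apply: measurable_funTS; apply: continuous_measurable_fun.
  exact: continuous_bump.
move=> x _ /=; rewrite lee_fin normrM ler_piMr//.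
by have /andP[b0 b1] := bump_range a b n x; rewrite ger0_norm.
Qed.

(** Testing against bumps gives zero integrals, and dominated convergence with bound |g1 - g2|
    replaces the bump by the indicator of ]a, b[. The half-open interval is the form in which the
    result is differentiated later. *)
Lemma weak_derivative_Rintegral_itv (h g1 g2 : R -> R) a b :
  weak_derivative h g1 -> weak_derivative h g2 -> 0 < a -> a < b ->
  \int[leb]_(x in `]a, b]) (g1 x - g2 x) = 0.
Proof.
move=> [lh l1 w1] [_ l2 w2] a0 ab; pose g x := g1 x - g2 x.
have lg : locally_integrable Rpos g by exact: (locally_integrableB l1 l2).
have ig := locally_integrable_itv _ _ b a0 lg.
have mitv : measurable (`[a, b]%classic : set R) by exact: measurable_itv.
have /integrableP[/measurable_EFinP mg _] := ig.
have g0 n : \int[leb]_(x in `[a, b]) (g x * bump a b n x) = 0.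
  have := w1 _ (test_function_bump _ _ n a0 ab).
  rewrite w2; last exact: test_function_bump.
  move=> /oppr_inj; rewrite !Rintegral_bump// => /esym/eqP; rewrite -subr_eq0.
  rewrite -RintegralB//; [|exact: integrable_bump..].
  by move=> /eqP <-; apply: eq_Rintegral => x _; rewrite mulrBl.
have cv : \int[leb]_(x in `[a, b]) (g x * bump a b n x) @[n --> \oo] -->
    \int[leb]_(x in `[a, b]) (g x * (\1_(`]a, b[%classic) x : R)).
  apply: (@dominated_cvg_Rintegral _ _ _ leb _ _ _ (fun x => `|g x|)) => //.
  - move=> n; apply/measurable_EFinP; apply: measurable_int.
    exact: integrable_bump.
  - exact: measurable_funM.
  - by move=> x _; apply: cvgM; [exact: cvg_cst|exact: cvg_bump].
  - exact: integrable_norm.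
  - move=> n x _; rewrite normrM ler_piMr//.
    by have /andP[b0 b1] := bump_range a b n x; rewrite ger0_norm.
have {}cv : \int[leb]_(x in `[a, b]) (g x * (\1_(`]a, b[%classic) x : R)) = 0.
  have cv0 : \int[leb]_(x in `[a, b]) (g x * bump a b n x) @[n --> \oo] -->
      (0 : R).
    by under eq_fun do rewrite g0; exact: cvg_cst.
  exact: (cvg_unique _ cv cv0).
rewrite -Rintegral_itv_bndo_bndc; last first.
  apply: (@integrableS _ _ R leb _ _ _ mitv _ _ ig).
    exact: measurable_itv.
  by apply: subset_itvW.
rewrite -cv.
have sub : `]a, b[ `<=` `[a, b] by exact: subset_itvW.
rewrite -[X in Rintegral _ X _](setIidr sub) Rintegral_mkcondr.
apply: eq_Rintegral => x _; rewrite patchE indicE.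
by case: ifP; rewrite ?mulr1 ?mulr0.
Qed.

End Bumps.

(** * Almost everywhere uniqueness by Lebesgue differentiation *)

Section WeakUniqueness.
Context {R : realType}.
Implicit Types (a b x y : R) (n : nat).
Local Notation leb := (@lebesgue_measure R).

(** At almost every point the indefinite integral has derivative [g]; on ]a, b[ it is constantly
    0. *)
Lemma ae_eq0_of_Rintegral_itv (g : R -> R) a b : a < b ->
  leb.-integrable `[a, b] (EFin \o g) ->
  (forall y, a < y -> y <= b -> \int[leb]_(x in `]a, y]) g x = 0) ->
  {ae leb, forall x, a < x -> x < b -> g x = 0}.
Proof.
move=> ab ig g0; have mitv : measurable (`[a, b]%classic : set R).
  exact: measurable_itv.
(* Extension by zero, so that [FTC1] applies on the whole line. *)
pose G := g \_ `[a, b].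
have iG : leb.-integrable setT (EFin \o G).
  by rewrite /G -restrict_EFin; apply/integrable_restrict; rewrite ?setTI.
have locG : locally_integrable setT G by exact: integrable_locally_restrict ig.
have iGy y : leb.-integrable [set` Interval (BRight a) (BRight y)] (EFin \o G).
  by apply: integrableS iG => //; exact: measurable_itv.
have := FTC1 iGy locG.
apply: filterS; first exact: (ae_filter_ringOfSetsType leb).
move=> x H ax xb; have /H[_] : (BRight a < BRight x)%O by rewrite bnd_simp.
have -> : G x = g x by rewrite /G patchE mem_set//= in_itv/= !ltW.
move=> <-; rewrite derive1E.
transitivity ('D_1 (cst (0 : R)) x); last by rewrite derive_cst.
apply: near_eq_derive; rewrite ?oner_neq0//.
near=> y.
have ay : a < y by near: y; exact: lt_nbhsr.
have yb : y <= b by apply: ltW; near: y; exact: lt_nbhsl.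
rewrite /= -(g0 y)//; apply: eq_Rintegral => z.
rewrite inE /= in_itv/= => /andP[az zy].
by rewrite /G patchE mem_set//= in_itv/= (ltW az) (le_trans zy).
Unshelve. all: by end_near. Qed.

Lemma weak_derivative_unique (h g1 g2 : R -> R) :
  weak_derivative h g1 -> weak_derivative h g2 ->
  {ae leb, forall x, Rpos x -> g1 x = g2 x}.
Proof.
move=> w1 w2; pose g x := g1 x - g2 x.
have lg : locally_integrable Rpos g.
  by case: w1 w2 => [_ l1 _] [_ l2 _]; exact: (locally_integrableB l1 l2).
(* These intervals exhaust (0, +oo), and countably many null sets are discarded. The shift by 2
   makes them nonempty from n = 0 on. *)
have H n : {ae leb, forall x, n.+2%:R^-1 < x -> x < n.+2%:R -> g x = 0}.
  have n0 : 0 < n.+2%:R^-1 :> R by rewrite invr_gt0.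
  apply: ae_eq0_of_Rintegral_itv.
  - by rewrite (@lt_trans _ _ 1)// ?invf_lt1 ?ltr1n.
  - exact: locally_integrable_itv.
  - move=> y ny _.
    exact: (weak_derivative_Rintegral_itv h _ _ _ _ w1 w2 n0 ny).
have AE : {ae leb, forall x n, n.+2%:R^-1 < x -> x < n.+2%:R -> g x = 0}.
  exact: ae_foralln.
apply: filterS AE; first exact: (ae_filter_ringOfSetsType leb).
move=> x Hx /RposE x0; apply/eqP; rewrite -subr_eq0; apply/eqP.
near \oo => n; apply: (Hx n).
  rewrite -[x]invrK ltf_pV2 ?posrE ?invr_gt0//.
  by near: n; exact: (nbhs_infty_gtr_add _ 2).
by near: n; exact: (nbhs_infty_gtr_add _ 2).
Unshelve. all: by end_near. Qed.

End WeakUniqueness.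

(** * Discriminant and conclusion *)

Section Assembly.
Context {R : realType}.
Implicit Types (f g h : R -> R) (mu lam c A B C P x : R).
Local Notation leb := (@lebesgue_measure R).

(** These bounds make every integral of the final identity converge separately. *)
Lemma le_energy mu x p q r : 0 < x ->
  [/\ r ^+ 2 * x `^ (mu + 1) <= energy mu x p q r,
      q ^+ 2 * x `^ mu <= energy mu x p q r,
      x ^+ 2 * q ^+ 2 * x `^ (mu - 1) <= energy mu x p q r &
      p ^+ 2 * x `^ (mu - 1) <= energy mu x p q r].
Proof.
move=> x0; rewrite energyE// powR_succ// (powR_pred mu)//.
set S := _ + p ^+ 2; have X0 := powR_ge0 x (mu - 1).
move: (x `^ (mu - 1)) X0 => X X0.
have [Sr Sxq Sq Sp] : [/\ (x * r) ^+ 2 <= S, (x * q) ^+ 2 <= S, q ^+ 2 <= S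
  & p ^+ 2 <= S] by exact: sqr_le_sum4.
split.
- by rewrite mulrA -exprMn mulrC (mulrC r) ler_wpM2l.
- rewrite mulrCA mulrC mulrAC (mulrC _ X) -mulrA ler_wpM2l//.
  (* The intermediate weight comes from 2 x q^2 <= (x q)^2 + q^2. *)
  have := sqr_ge0 (x * q - q); rewrite sqrrB.
  have -> : x * q * q = q ^+ 2 * x by ring.
  by lra.
- by rewrite -exprMn mulrC ler_wpM2l.
- by rewrite mulrC ler_wpM2l.
Qed.

(** The square is the [defect] plus the three other terms. All are integrable, and the [defect]
    contributes 0. *)
Lemma integral_square_expand mu f g h :
  measurable_fun Rpos f -> measurable_fun Rpos g -> measurable_fun Rpos h ->
  leb.-integrable Rpos (EFin \o fun x => energy mu x (f x) (g x) (h x)) ->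
  (forall lam c,
    \int[leb]_(x in Rpos) defect mu lam c x (f x) (g x) (h x) = 0) ->
  forall lam c, \int[leb]_(x in Rpos)
    ((x * h x + lam * x * g x + mu * g x + lam * c * f x) ^+ 2 * x `^ (mu - 1))
  = lam ^+ 2 * \int[leb]_(x in Rpos)
      ((x ^+ 2 * g x ^+ 2 - c * (mu - c) * f x ^+ 2) * x `^ (mu - 1))
    - lam * (2 * c - mu + 1) * \int[leb]_(x in Rpos) (g x ^+ 2 * x `^ mu)
    + \int[leb]_(x in Rpos) (h x ^+ 2 * x `^ (mu + 1)).
Proof.
move=> mf mg mh ie d0 lam c.
have mp a : measurable_fun (@Rpos R) (fun x : R => x `^ a).
  exact: measurable_powR_pos.
have M k l := @measurable_funM _ _ R (@Rpos R) k l.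
have sq (k : R -> R) : measurable_fun Rpos k ->
    measurable_fun Rpos (fun x => k x ^+ 2) by move=> mk; exact: M.
have id : measurable_fun Rpos (fun x : R => x) by exact: measurable_id.
have cst a : measurable_fun (@Rpos R) (fun=> a : R) by exact: measurable_cst.
have iC : leb.-integrable Rpos (EFin \o (fun x => h x ^+ 2 * x `^ (mu + 1))).
  have mC := M _ _ (sq _ mh) (mp (mu + 1)).
  apply: (le_integrable_Rpos _ _ mC ie) => y y0 /=.
  rewrite ger0_norm; last by rewrite mulr_ge0 ?sqr_ge0 ?powR_ge0.
  by have [] := le_energy mu y (f y) (g y) (h y) y0.
have iB : leb.-integrable Rpos (EFin \o (fun x => g x ^+ 2 * x `^ mu)).
  have mB := M _ _ (sq _ mg) (mp mu).
  apply: (le_integrable_Rpos _ _ mB ie) => y y0 /=.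
  rewrite ger0_norm; last by rewrite mulr_ge0 ?sqr_ge0 ?powR_ge0.
  by have [] := le_energy mu y (f y) (g y) (h y) y0.
have iA : leb.-integrable Rpos (EFin \o (fun x =>
    (x ^+ 2 * g x ^+ 2 - c * (mu - c) * f x ^+ 2) * x `^ (mu - 1))).
  have mA := M _ _ (@measurable_funB _ _ R (@Rpos R) _ _
    (M _ _ (sq _ id) (sq _ mg)) (M _ _ (cst (c * (mu - c))) (sq _ mf)))
    (mp (mu - 1)).
  have ie' := integrableZ_Rpos (1 + `|c * (mu - c)|) _ ie.
  apply: (le_integrable_Rpos _ _ mA ie') => y y0 /=.
  have [_ _ a1 a2] := le_energy mu y (f y) (g y) (h y) y0.
  rewrite mulrBl; apply: (le_trans (ler_normB _ _)).
  rewrite mulrDl mul1r; apply: lerD.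
    by rewrite ger0_norm// mulr_ge0 ?powR_ge0// mulr_ge0 ?sqr_ge0.
  rewrite -[_ * f y ^+ 2 * _]mulrA [leLHS]normrM; apply: ler_wpM2l => //.
  by rewrite ger0_norm// mulr_ge0 ?sqr_ge0 ?powR_ge0.
have id_ := integrable_defect mu lam c _ _ _ mf mg mh ie.
have iA' := integrableZ_Rpos (lam ^+ 2) _ iA.
have iB' := integrableZ_Rpos (- (lam * (2 * c - mu + 1))) _ iB.
have iAB := integrableD_Rpos _ _ iA' iB'.
have iABC := integrableD_Rpos _ _ iAB iC.
rewrite -mulNr -(RintegralZ_Rpos _ _ iA) -(RintegralZ_Rpos _ _ iB).
rewrite -(RintegralD_Rpos _ _ iA' iB') -(RintegralD_Rpos _ _ iAB iC).
rewrite -[RHS]add0r -(d0 lam c) -(RintegralD_Rpos _ _ id_ iABC).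
by apply: eq_Rintegral => x _; rewrite /defect mulNr subrK.
Qed.

(** The sign of [A] is not given: A < 0 is contradictory, A > 0 is settled at the minimum, and A = 0
    forces P = 0. *)
Lemma discriminant_le A P C : (forall lam, 0 <= lam ^+ 2 * A - lam * P + C) ->
  4^-1 * P ^+ 2 <= C * A.
Proof.
move=> H; have C0 : 0 <= C by have := H 0; rewrite expr0n !mul0r subr0 add0r.
have [A0|A0|A0] := ltgtP A 0.
(* The values at [t] and [-t] have sum 2 (t^2 A + C), at most 2 (A - 1) < 0. *)
- pose t := 1 + (C + 1) / - A.
  have t1 : 1 <= t by rewrite /t lerDl divr_ge0 ?addr_ge0// oppr_ge0 ltW.
  have tA : t * A = A - (C + 1) by rewrite /t; field; rewrite lt_eqF.
  have := H t; have := H (- t); rewrite sqrrN.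
  have : t ^+ 2 * A <= t * A.
    by rewrite ler_nM2r// expr2 ler_peMl// (le_trans ler01).
  by lra.
- have := H (P / (2 * A)).
  rewrite [X in 0 <= X](_ : _ = C - 4^-1 * P ^+ 2 / A); last first.
    by field; rewrite gt_eqF.
  by rewrite subr_ge0 ler_pdivrMr.
- have [->|P0] := eqVneq P 0; first by rewrite A0 expr0n !mulr0.
  (* Here the affine function takes the value -1. *)
  have := H ((C + 1) / P); rewrite A0 mulr0 divfK// add0r.
  by lra.
Qed.

Lemma ae_eq_Rintegral_Rpos (F G k l : R -> R) :
  {ae leb, forall x, Rpos x -> k x = l x} ->
  measurable_fun Rpos F -> measurable_fun Rpos G ->
  (forall x, k x = l x -> F x = G x) ->
  \int[leb]_(x in Rpos) F x = \int[leb]_(x in Rpos) G x.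
Proof.
move=> kl mF mG FG; congr fine; apply: ae_eq_integral.
- exact: measurable_Rpos.
- exact/measurable_EFinP.
- exact/measurable_EFinP.
- apply: filterS kl; first exact: (ae_filter_ringOfSetsType leb).
  by move=> x H /H /FG ->.
Qed.

(** Passage between the given weak derivative and the one from the completion, in the two integrals
    that contain the second derivative. *)
Lemma Rintegral_weak_derivative_eq mu lam c f g h h' :
  {ae leb, forall x, Rpos x -> h x = h' x} ->
  measurable_fun Rpos f -> measurable_fun Rpos g ->
  measurable_fun Rpos h -> measurable_fun Rpos h' ->
  \int[leb]_(x in Rpos) ((x * h x + lam * x * g x + mu * g x + lam * c * f x)
    ^+ 2 * x `^ (mu - 1)) =
  \int[leb]_(x in Rpos) ((x * h' x + lam * x * g x + mu * g x + lam * c * f x)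
    ^+ 2 * x `^ (mu - 1)) /\
  \int[leb]_(x in Rpos) (h x ^+ 2 * x `^ (mu + 1)) =
  \int[leb]_(x in Rpos) (h' x ^+ 2 * x `^ (mu + 1)).
Proof.
move=> hh' mf mg mh mh'.
have mp a : measurable_fun (@Rpos R) (fun x : R => x `^ a).
  exact: measurable_powR_pos.
have D k l := @measurable_funD _ _ R (@Rpos R) k l.
have M k l := @measurable_funM _ _ R (@Rpos R) k l.
have sq (k : R -> R) : measurable_fun Rpos k ->
    measurable_fun Rpos (fun x => k x ^+ 2) by move=> mk; exact: M.
have id : measurable_fun Rpos (fun x : R => x) by exact: measurable_id.
have cst a : measurable_fun (@Rpos R) (fun=> a : R) by exact: measurable_cst.
have mL k (mk : measurable_fun Rpos k) := M _ _ (sq _ (D _ _ (D _ _ (D _ _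
  (M _ _ id mk) (M _ _ (M _ _ (cst lam) id) mg)) (M _ _ (cst mu) mg))
  (M _ _ (cst (lam * c)) mf))) (mp (mu - 1)).
have mS k (mk : measurable_fun Rpos k) := M _ _ (sq _ mk) (mp (mu + 1)).
split; first by apply: (ae_eq_Rintegral_Rpos _ _ _ _ hh' (mL _ mh) (mL _ mh'))
  => x /= ->.
by apply: (ae_eq_Rintegral_Rpos _ _ _ _ hh' (mS _ mh) (mS _ mh')) => x /= ->.
Qed.

End Assembly.

Theorem theorem2 (R : realType) (mu eps : R) (heps : eps <= mu ^+ 2 / 4)
    (f f2 : R -> R) (hf : Ebar mu f) (hf2 : weak_derivative (derive1 f) f2) :
  let b := (mu - Num.sqrt (mu ^+ 2 - 4 * eps)) / 2 in
  \int[lebesgue_measure]_(x in Rpos)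
     ((x * f2 x + x * derive1 f x + mu * derive1 f x + (mu - b) * f x) ^+ 2
      * x `^ (mu - 1))
  = \int[lebesgue_measure]_(x in Rpos)
      ((x ^+ 2 * derive1 f x ^+ 2 - eps * f x ^+ 2) * x `^ (mu - 1))
    - (Num.sqrt (mu ^+ 2 - 4 * eps) + 1)
      * \int[lebesgue_measure]_(x in Rpos) (derive1 f x ^+ 2 * x `^ mu)
    + \int[lebesgue_measure]_(x in Rpos) (f2 x ^+ 2 * x `^ (mu + 1))
  /\
  4^-1 * (Num.sqrt (mu ^+ 2 - 4 * eps) + 1) ^+ 2
    * (\int[lebesgue_measure]_(x in Rpos) (derive1 f x ^+ 2 * x `^ mu)) ^+ 2
  <= (\int[lebesgue_measure]_(x in Rpos) (f2 x ^+ 2 * x `^ (mu + 1)))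
     * (\int[lebesgue_measure]_(x in Rpos)
          ((x ^+ 2 * derive1 f x ^+ 2 - eps * f x ^+ 2) * x `^ (mu - 1))).
Proof.
have [cf [f2' [wf' [u [Eu cvu]]]]] := hf.
have [_ [mf2' _ _] _] := wf'; have [_ [mf2 _ _] _] := hf2.
have mf : measurable_fun Rpos f.
  by apply: measurable_fun_Rpos => x /(C1_on_continuous _ _ cf)[].
have mf1 : measurable_fun Rpos (derive1 f).
  by apply: measurable_fun_Rpos => x /(C1_on_continuous _ _ cf)[].
have [ie d0] := Ebar_integral_defect_eq0 _ _ _ cf mf2'
  (ex_intro _ u (conj Eu cvu)).
have ae := weak_derivative_unique _ _ _ hf2 wf'.
have E lam c :=
  Rintegral_weak_derivative_eq mu lam c _ _ _ _ ae mf mf1 mf2 mf2'.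
have S lam c := integral_square_expand _ _ _ _ mf mf1 mf2' ie d0 lam c.
move=> b; set s := Num.sqrt _.
(* The bound on [eps] makes the radicand nonnegative; [Num.sqrt] is 0 on negative numbers. *)
have s2 : s ^+ 2 = mu ^+ 2 - 4 * eps.
  by rewrite sqr_sqrtr// subr_ge0 mulrC -ler_pdivlMr.
have cE : (mu - b) * (mu - (mu - b)) = eps.
  have -> : (mu - b) * (mu - (mu - b)) = (mu ^+ 2 - s ^+ 2) / 4.
    by rewrite /b -/s; field.
  by rewrite s2; field.
have sE : 2 * (mu - b) - mu + 1 = s + 1 by rewrite /b -/s; field.
have {}S lam := S lam (mu - b); rewrite cE sE in S.
have [_ ->] := E 1 (mu - b).
split.
  have [E1 _] := E 1 (mu - b).
  have := S 1; rewrite -E1 expr1n !mul1r => <-.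
  by apply: eq_Rintegral => x _; rewrite !mul1r.
(* The quadratic in [lam] is the integral of a weighted square, with [P] equal to s + 1 times the
   integral of f'^2 x^mu. *)
rewrite -mulrA -exprMn; apply: discriminant_le => lam.
rewrite mulrA -S; apply: Rintegral_ge0 => x _.
by rewrite mulr_ge0 ?sqr_ge0 ?powR_ge0.
Qed.
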